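(* Let $P\in\mathbb{F}_{q^r}[X,\sigma]$ be a monic polynomial. The polynomial $P$ is irreducible in $\mathbb{F}_{q^r}[X,\sigma]$ if and only if $\Psi(P)$ is irreducible in $\mathbb{F}_q[Y]$.
   Context: Let $p$ be a prime, $q=p^a$, $r\ge1$, $\sigma(x)=x^q$ on $\mathbb{F}_{q^r}$. $\mathbb{F}_{q^r}[X,\sigma]$ is the skew polynomial ring with $X\cdot c=\sigma(c)\cdot X$ for $c\in\mathbb{F}_{q^r}$. For monic $P=X^d-\sum_{i=0}^{d-1}a_iX^i$, let $D_P=\bigoplus_{i=0}^{d-1}\mathbb{F}_{q^r}e_i$ with the $\sigma$-semi-linear map $\varphi$ given by $\varphi(e_i)=e_{i+1}$ for $0\le i\le d-2$ and $\varphi(e_{d-1})=\sum_{i=0}^{d-1}a_ie_i$. Then $\varphi^r$ is $\mathbb{F}_{q^r}$-linear, and $\Psi(P)=\det(Y\,\mathrm{id}-\varphi^r)$, its characteristic polynomial, which lies in $\mathbb{F}_q[Y]$ (commutative polynomials). *)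

(* Defs.v *)
From HB Require Import structures.
From mathcomp Require Import all_boot all_order all_fingroup all_algebra.
From mathcomp Require Import all_solvable all_field.

Set Implicit Arguments.
Unset Strict Implicit.
Unset Printing Implicit Defensive.

Import GRing.Theory.
Local Open Scope ring_scope.

(* The skew polynomial ring R[X, s]: an element \sum_i a_i X^i, with the
   coefficients written on the left, is stored as the polynomial with
   coefficients a_i, so that addition, [size], [lead_coef] and [monic] are those
   of {poly R}; only the product is twisted, by (a X^i)(b X^j) = a s^i(b) X^(i+j). *)
Definition skewpoly (R : nzRingType) (s : {rmorphism R -> R}) : Type := {poly R}.

Identity Coercion poly_of_skewpoly : skewpoly >-> polynomial.

Section SkewPoly.

Variables (R : nzRingType) (s : {rmorphism R -> R}).
Implicit Types p q r : {poly R}.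

Definition skew_mul p q : {poly R} :=
  \poly_(k < (size p + size q).-1) \sum_(i < k.+1) p`_i * iter i s q`_(k - i).

Fact iter_rmorph0 n : iter n s 0 = 0.
Proof. by elim: n => //= n ->; rewrite rmorph0. Qed.

Fact iter_rmorph1 n : iter n s 1 = 1.
Proof. by elim: n => //= n ->; rewrite rmorph1. Qed.

Fact iter_rmorphD n x y : iter n s (x + y) = iter n s x + iter n s y.
Proof. by elim: n => //= n ->; rewrite rmorphD. Qed.

Fact iter_rmorphM n x y : iter n s (x * y) = iter n s x * iter n s y.
Proof. by elim: n => //= n ->; rewrite rmorphM. Qed.

Fact iter_rmorph_sum n I (t : seq I) (E : I -> R) :
  iter n s (\sum_(i <- t) E i) = \sum_(i <- t) iter n s (E i).
Proof. exact: (big_morph _ (iter_rmorphD n) (iter_rmorph0 n)). Qed.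

Lemma coef_skew_mul p q k :
  (skew_mul p q)`_k = \sum_(i < k.+1) p`_i * iter i s q`_(k - i).
Proof.
rewrite coef_poly ltn_predRL; case: leqP => // le_pq_k1.
rewrite big1 // => j _; have [lq_p_j|lt_j_p] := leqP (size p) j.
  by rewrite nth_default ?mul0r.
rewrite [q`__]nth_default ?iter_rmorph0 ?mulr0 // leq_subRL -ltnS //.
by rewrite (leq_trans _ le_pq_k1) // ltn_add2r.
Qed.

Fact coef_skew_mul_rev p q k :
  (skew_mul p q)`_k = \sum_(i < k.+1) p`_(k - i) * iter (k - i) s q`_i.
Proof.
rewrite coef_skew_mul (reindex_inj rev_ord_inj) /=.
by apply: eq_bigr => j _; rewrite (sub_ordK j).
Qed.

Fact skew_mulA : associative skew_mul.
Proof.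
move=> p q r; apply/polyP=> i; rewrite coef_skew_mul coef_skew_mul_rev.
pose coef3 j k := p`_j * iter j s (q`_(i - j - k) * iter (i - j - k) s r`_k).
transitivity (\sum_(j < i.+1) \sum_(k < i.+1 | (k <= i - j)%N) coef3 j k).
  apply: eq_bigr => /= j _.
  rewrite coef_skew_mul_rev iter_rmorph_sum big_distrr /=.
  by rewrite (big_ord_narrow_leq (leq_subr _ _)).
rewrite (exchange_big_dep predT) //=; apply: eq_bigr => k _.
transitivity (\sum_(j < i.+1 | (j <= i - k)%N) coef3 j k).
  apply: eq_bigl => j; rewrite -ltnS -(ltnS j) -!subSn ?leq_ord //.
  by rewrite -subn_gt0 -(subn_gt0 j) -!subnDA addnC.
rewrite (big_ord_narrow_leq (leq_subr _ _)) coef_skew_mul big_distrl /=.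
apply: eq_bigr => j _; rewrite /coef3 iter_rmorphM mulrA -iterD.
have le_jik : (j <= i - k)%N by rewrite -ltnS.
by rewrite -!subnDA addnC !subnDA subnKC.
Qed.

Fact skew_mul1l : left_id 1%:P skew_mul.
Proof.
move=> p; apply/polyP => i; rewrite coef_skew_mul big_ord_recl subn0.
by rewrite big1 => [|j _]; rewrite coefC /= ?mul1r ?addr0 ?mul0r.
Qed.

Fact skew_mul1r : right_id 1%:P skew_mul.
Proof.
move=> p; apply/polyP => i; rewrite coef_skew_mul_rev big_ord_recl subn0.
rewrite big1 => [|j _]; rewrite coefC /=.
  by rewrite iter_rmorph1 mulr1 addr0.
by rewrite iter_rmorph0 mulr0.
Qed.

Fact skew_mulDl : left_distributive skew_mul +%R.
Proof.
move=> p q r; apply/polyP=> i; rewrite coefD !coef_skew_mul -big_split.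
by apply: eq_bigr => j _; rewrite coefD mulrDl.
Qed.

Fact skew_mulDr : right_distributive skew_mul +%R.
Proof.
move=> p q r; apply/polyP=> i; rewrite coefD !coef_skew_mul -big_split.
by apply: eq_bigr => j _; rewrite coefD iter_rmorphD mulrDr.
Qed.

HB.instance Definition _ := GRing.Zmodule.on (skewpoly s).
HB.instance Definition _ := GRing.Zmodule_isNzRing.Build (skewpoly s)
  skew_mulA skew_mul1l skew_mul1r skew_mulDl skew_mulDr (@poly1_neq0 R).

Lemma skewpolyXC (c : R) :
  ('X : skewpoly s) * (c%:P : skewpoly s)
    = ((s c)%:P : skewpoly s) * ('X : skewpoly s).
Proof.
apply/polyP => k; rewrite [LHS]coef_skew_mul [RHS]coef_skew_mul.
case: k => [|k].
  by rewrite !big_ord_recl !big_ord0 !coefX !mul0r mulr0.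
rewrite 2!big_ord_recl big1 => [|i _]; last by rewrite coefX mul0r.
rewrite [RHS]big_ord_recl big1 => [|i _]; last by rewrite coefC mul0r.
rewrite !coefX !coefC /= mul0r mul1r add0r !addr0.
by rewrite /bump /= subSS subn0; case: k => [|k]; rewrite ?mulr1 ?rmorph0 ?mulr0.
Qed.

End SkewPoly.

Section Irreducible.

Variable R : nzRingType.

Definition is_unit (x : R) : Prop := exists y : R, y * x = 1 /\ x * y = 1.

Definition irreducible (x : R) : Prop :=
  [/\ x <> 0, ~ is_unit x
    & forall y z : R, x = y * z -> is_unit y \/ is_unit z].

End Irreducible.

(* A field K of type [fieldExtType F], with F finite, is the extension
   F_(q^r) / F_q where q = #|F| and r = \dim {:K}; F_q embeds in K by [in_alg]. *)
Section Frobenius.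

Variables (F : finFieldType) (K : fieldExtType F).

Definition frob (x : K) : K := x ^+ #|F|.

Fact frob_is_nmod_morphism : nmod_morphism frob.
Proof.
have q_gt0 : (0 < #|F|)%N by apply/card_gt0P; exists 0.
split=> [|x y]; first by rewrite /frob expr0n eqn0Ngt q_gt0.
have [p pr_p pcharFp] := finPcharP F.
apply: exprDn_pchar; rewrite (card_pprimeChar pcharFp) pnatX pnatE //.
by rewrite (pchar_lalg K) pcharFp.
Qed.

Fact frob_is_monoid_morphism : monoid_morphism frob.
Proof. by split=> [|x y]; rewrite /frob ?expr1n ?exprMn. Qed.

HB.instance Definition _ :=
  GRing.isNmodMorphism.Build K K frob frob_is_nmod_morphism.
HB.instance Definition _ :=
  GRing.isMonoidMorphism.Build K K frob frob_is_monoid_morphism.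

Definition sigma : {rmorphism K -> K} := GRing.RMorphism.clone K K frob _.

Lemma sigmaE x : sigma x = x ^+ #|F|. Proof. by []. Qed.

Lemma iter_sigma n x : iter n sigma x = x ^+ (#|F| ^ n).
Proof.
by elim: n => [|n IHn]; rewrite ?expr1 // iterS IHn expnSr exprM.
Qed.

Lemma iter_sigma_dim x : iter (\dim {:K}) sigma x = x.
Proof.
rewrite iter_sigma.
have <- : #|finvect_type K| = (#|F| ^ \dim {:K})%N.
  rewrite -(card_vspacef (Vector.class (finvect_type K : vectType F))).
  exact: card_vspace.
exact: (expf_card (x : finvect_type K)).
Qed.

Lemma sigma_fixedP x : sigma x = x -> exists c : F, x = c%:A.
Proof.
move=> xFx; have : root (map_poly (in_alg K) ('X^#|F| - 'X)) x.
  by rewrite rmorphB /= map_polyXn map_polyX rootE !hornerE [x ^+ _]xFx subrr.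
rewrite finField_genPoly rmorph_prod rootE horner_prod prodf_seq_eq0.
case/hasP => c _ /=; rewrite map_polyXsubC hornerXsubC subr_eq0 => /eqP ->.
by exists c.
Qed.

End Frobenius.

Arguments sigma {F} K.

Section Psi.

Variables (F : finFieldType) (K : fieldExtType F).
Implicit Type P : skewpoly (sigma K).

(* The module D_P with basis e_i = [delta_mx 0 i], and its semi-linear map.
   Row i of [companionmx P] holds the coordinates of the image of e_i; since
   P = X^d - \sum_i a_i X^i, its last row - P`_j is (a_0, ..., a_(d-1)). *)
Definition phi P (v : 'rV[K]_(size P).-1) : 'rV[K]_(size P).-1 :=
  map_mx (sigma K) v *m companionmx P.
Arguments phi : clear implicits.

Lemma phiD P u v : phi P (u + v) = phi P u + phi P v.
Proof. by rewrite /phi map_mxD mulmxDl. Qed.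

Lemma phiZ P c v : phi P (c *: v) = sigma K c *: phi P v.
Proof. by rewrite /phi map_mxZ scalemxAl. Qed.

Lemma phi_delta P (i : 'I_(size P).-1) (lt_i1 : (i.+1 < (size P).-1)%N) :
  phi P (delta_mx 0 i) = delta_mx 0 (Ordinal lt_i1).
Proof. by rewrite /phi map_delta_mx mulmx_delta_companion. Qed.

Lemma phi_delta_last P (i : 'I_(size P).-1) : i = (size P).-2 :> nat ->
  phi P (delta_mx 0 i) = \sum_(j < (size P).-1) - P`_j *: delta_mx 0 j.
Proof.
move=> i_last; rewrite /phi map_delta_mx -rowE.
apply/rowP => j; rewrite summxE (bigD1 j) //= big1 => [|k /negPf neq_kj].
  by rewrite !mxE i_last !eqxx mulr1 addr0.
by rewrite !mxE eqxx eq_sym neq_kj mulr0.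
Qed.

Lemma phi_iterZ P c v :
  iter (\dim {:K}) (phi P) (c *: v) = c *: iter (\dim {:K}) (phi P) v.
Proof.
rewrite -[in RHS](iter_sigma_dim c).
by elim: (\dim _) => //= n ->; rewrite phiZ.
Qed.

Lemma phi_iterD P u v : iter (\dim {:K}) (phi P) (u + v)
  = iter (\dim {:K}) (phi P) u + iter (\dim {:K}) (phi P) v.
Proof. by elim: (\dim _) => //= n ->; rewrite phiD. Qed.

Definition PsiK P : {poly K} := char_poly (lin1_mx (iter (\dim {:K}) (phi P))).

Fact char_poly_mulmxC n (A B : 'M[K]_n) :
  char_poly (A *m B) = char_poly (B *m A).
Proof.
pose A' := map_mx polyC A; pose B' := map_mx polyC B.
pose M := block_mx 'X%:M A' B' 1%:M : 'M_(n + n).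
have detAB : \det M = char_poly (A *m B).
  have -> : \det M = \det (M *m block_mx 1%:M 0 (- B') 1%:M).
    by rewrite det_mulmx det_lblock !det1 !mulr1.
  rewrite mulmx_block.
  rewrite !mulmx1 !mul1mx !mulmx0 !add0r mulmxN subrr det_ublock det1 mulr1.
  by rewrite /char_poly /char_poly_mx map_mxM.
have detBA : 'X ^+ n * \det M = 'X ^+ n * char_poly (B *m A).
  have -> : 'X ^+ n * \det M = \det (block_mx 1%:M 0 (- B') 'X%:M *m M).
    by rewrite det_mulmx det_lblock det1 det_scalar mul1r.
  rewrite mulmx_block.
  rewrite !mulmx1 !mul1mx !mul0mx !addr0 mulNmx.
  rewrite -scalar_mxC addNr det_ublock det_scalar; congr (_ * _).
  by rewrite /char_poly /char_poly_mx map_mxM addrC mulNmx.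
have nzX : 'X ^+ n != 0 :> {poly K} by rewrite expf_neq0 // polyX_eq0.
by rewrite -detAB; apply: (mulfI nzX); exact: detBA.
Qed.

Fact PsiK_sigma P : map_poly (sigma K) (PsiK P) = PsiK P.
Proof.
set d := (size P).-1; pose M : 'M[K]_d := companionmx P.
pose N := fix N k : 'M[K]_d :=
  if k is k'.+1 then map_mx (sigma K) (N k') *m M else 1%:M.
have iter_phi k v :
    iter k (phi P) v = map_mx (iter k (sigma K)) v *m N k.
  elim: k => [|k IHk] /=; first by rewrite mulmx1 map_mx_id.
  rewrite IHk /phi map_mxM -mulmxA; congr (_ *m _).
  by apply/rowP=> j; rewrite !mxE.
have NSl k : N k.+1 = map_mx (iter k (sigma K)) M *m N k.
  elim: k => [|k IHk].
    by rewrite /= map_mx1 mul1mx mulmx1; apply/matrixP=> i j; rewrite [RHS]mxE.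
  have -> : N k.+2 = map_mx (sigma K) (N k.+1) *m M by [].
  rewrite {1}IHk map_mxM -mulmxA; congr (_ *m _).
  by apply/matrixP=> i j; rewrite !mxE.
have PsiE : PsiK P = char_poly (N (\dim {:K})).
  congr char_poly; apply/matrixP => i j; rewrite mxE iter_phi.
  have -> : map_mx (iter (\dim {:K}) (sigma K)) (delta_mx 0 i)
      = delta_mx 0 i :> 'rV_d.
    by apply/rowP=> l; rewrite mxE iter_sigma_dim.
  by rewrite -rowE mxE.
have NSr k : N k.+1 = map_mx (sigma K) (N k) *m M by [].
clearbody N.
have sigma_char k : (forall x, iter k.+1 (sigma K) x = x) ->
    map_poly (sigma K) (char_poly (N k.+1)) = char_poly (N k.+1).
  move=> sigmaK; rewrite map_char_poly.
  have -> : map_mx (sigma K) (N k.+1) = M *m map_mx (sigma K) (N k).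
    rewrite NSl map_mxM; congr (_ *m _).
    by apply/matrixP=> i j; rewrite 2!mxE; apply: sigmaK.
  by rewrite char_poly_mulmxC -NSr.
have dimK : (\dim {:K}).-1.+1 = \dim {:K} by rewrite prednK ?adim_gt0.
rewrite PsiE -dimK; apply: sigma_char => x.
by rewrite dimK iter_sigma_dim.
Qed.

Fact Psi_subproof P : exists Q : {poly F}, map_poly (in_alg K) Q == PsiK P.
Proof.
have fixP i : exists c : F, (PsiK P)`_i == c%:A.
  have [|c ->] := @sigma_fixedP F K (PsiK P)`_i; last by exists c.
  by rewrite -[RHS](congr1 (fun q : {poly K} => q`_i) (PsiK_sigma P)) coef_map.
exists (\poly_(i < size (PsiK P)) xchoose (fixP i)).
apply/eqP/polyP => i; rewrite coef_map coef_poly.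
case: ltnP => [_ | le_i]; last by rewrite [RHS]nth_default //= scale0r.
exact: esym (eqP (xchooseP (fixP i))).
Qed.

(* The characteristic polynomial of the K-linear map phi^r, as an element of
   F_q[Y]: the unique Q with image [PsiK P] under F_q[Y] -> K[Y]. *)
Definition Psi P : {poly F} := xchoose (Psi_subproof P).

Lemma map_Psi P : map_poly (in_alg K) (Psi P) = PsiK P.
Proof. exact/eqP/(xchooseP (Psi_subproof P)). Qed.

End Psi.

Arguments phi {F K} P v.

(* Main.v *)
Require Import Defs.
From HB Require Import structures.
From mathcomp Require Import all_boot all_order all_fingroup all_algebra.
From mathcomp Require Import all_solvable all_field.

Set Implicit Arguments.
Unset Strict Implicit.
Unset Printing Implicit Defensive.

Import GRing.Theory.
Local Open Scope ring_scope.

(**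
Let V = D_P, f = phi^r, and let a skew polynomial act on V by substituting phi
for X; then e_0 generates V with annihilator K[X, sigma] P.

If P = S R properly, w = R e_0 is nonzero and killed by the monic multiple S'
of S.  By Cayley-Hamilton Psi(S')(X^r) is a left multiple of S', so Psi(S')(f)
kills w; as Psi(P)(f) = 0, a Bezout relation forbids Psi(P) to be irreducible,
since 0 < deg Psi(S') < deg Psi(P).

Conversely let P be irreducible, so that V has no proper nonzero phi-stable
subspace.  It suffices that every nonzero A in F_q[Y] with A(f) = 0 has degree
at least d = dim V: when Psi(P) = B A, one of B(f), A(f) has a nonzero kernel,
which is phi-stable, hence is all of V.  Let Q, irreducible over K, be such that
V_1 = ker Q(f) is nonzero, M = K[Y]/(Q), y the class of Y, and n the size of the
orbit of y under x -> x^q.  The n conjugates of y are roots of A, so n <= deg A,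
and a phi-stable subspace of dimension at most n shows d <= n.  To build it,
note that phi^n preserves V_1 and is semilinear over M for the automorphism
x -> x^(q^n), because y^(q^n) = y.  With g = gcd(n, r), the norm from M to the
field with q^n elements is onto, which gives u in M with norm y^(n/g).  Then
u^-1 phi^n has order dividing r/g on V_1, and averaging yields a nonzero v fixed
by it.  By Bezout phi^g v lies in M v, so the sum of the phi^i (M v), i < g, is
phi-stable, of dimension at most g [M : K] = n.  When Q = Y there is no such u,
but then phi kills some vector, which spans a phi-stable line.
*)

(** * Polynomials in a semilinear map *)

Section SkewProducts.

Variables (R : nzRingType) (s : {rmorphism R -> R}).
Implicit Types p q : {poly R}.

Lemma skew_mulX p : skew_mul s p 'X = p * 'X.
Proof.
apply/polyP => -[|k]; rewrite coef_skew_mul_rev coefMX.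
  by rewrite big_ord_recl big_ord0 coefX iter_rmorph0 mulr0 addr0.
rewrite 2!big_ord_recl big1 => [|i _].
  by rewrite !coefX iter_rmorph0 iter_rmorph1 mulr0 mulr1 add0r addr0 /= subn1.
by rewrite coefX iter_rmorph0 mulr0.
Qed.

Lemma skew_mulCl c p : skew_mul s c%:P p = c *: p.
Proof.
apply/polyP => k; rewrite coef_skew_mul coefZ big_ord_recl big1 => [|i _].
  by rewrite coefC addr0 subn0.
by rewrite coefC mul0r.
Qed.

Lemma skew_mulXl p : skew_mul s 'X p = map_poly s p * 'X.
Proof.
apply/polyP => -[|k]; rewrite coef_skew_mul coefMX.
  by rewrite big_ord_recl big_ord0 coefX mul0r addr0.
rewrite 2!big_ord_recl big1 => [|i _]; last by rewrite coefX mul0r.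
by rewrite !coefX mul0r mul1r add0r addr0 /= subn1 coef_map.
Qed.

End SkewProducts.

(** With the identity as twist, facts on the skew action specialise to linear maps. *)
Lemma skew_mul_id (R : comNzRingType) (p q : {poly R}) :
  skew_mul idfun p q = p * q.
Proof.
have iter_id n (x : R) : iter n idfun x = x by elim: n.
apply/polyP => k; rewrite coef_skew_mul coefM.
by under eq_bigr do rewrite iter_id.
Qed.

Section SemilinearAction.

Variables (R : nzRingType) (s : {rmorphism R -> R}) (V : lmodType R).
Variable phi : V -> V.
Hypothesis phiD : {morph phi : u v / u + v}.
Hypothesis phiZ : forall c v, phi (c *: v) = s c *: phi v.
Implicit Types (p q : {poly R}) (u v : V).

(* p(phi) v; for s-semilinear phi this is the action of R[X, s] on V. *)
Definition act p v := \sum_(i < size p) p`_i *: iter i phi v.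

Lemma act_wide n p v : (size p <= n)%N ->
  act p v = \sum_(i < n) p`_i *: iter i phi v.
Proof.
move=> le_pn; rewrite /act (big_ord_widen n (fun i => p`_i *: iter i phi v)) //.
rewrite big_mkcond; apply: eq_bigr => i _.
by case: ltnP => // le_pi; rewrite nth_default // scale0r.
Qed.

Lemma actDl p q v : act (p + q) v = act p v + act q v.
Proof.
pose n := maxn (size p) (size q).
rewrite !(@act_wide n) ?size_polyD ?leq_maxl ?leq_maxr //.
by rewrite -big_split; apply: eq_bigr => i _; rewrite coefD scalerDl.
Qed.

Lemma actZl c p v : act (c *: p) v = c *: act p v.
Proof.
rewrite (@act_wide (size p)) ?size_scale_leq // scaler_sumr.
by apply: eq_bigr => i _; rewrite coefZ scalerA.
Qed.

Lemma act0l v : act 0 v = 0.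
Proof. by rewrite /act size_poly0 big_ord0. Qed.

Lemma actBl p q v : act (p - q) v = act p v - act q v.
Proof. by rewrite actDl -(scaleN1r q) actZl scaleN1r. Qed.

Lemma actC c v : act c%:P v = c *: v.
Proof. by rewrite (@act_wide 1) ?size_polyC ?leq_b1 // big_ord1 coefC. Qed.

Lemma semilin0 : phi 0 = 0.
Proof. by rewrite -[X in phi X](scale0r 0) phiZ rmorph0 scale0r. Qed.

Lemma semilin_sum I (t : seq I) (E : I -> V) :
  phi (\sum_(i <- t) E i) = \sum_(i <- t) phi (E i).
Proof. exact: (big_morph _ phiD semilin0). Qed.

Lemma actMX p v : act (p * 'X) v = act p (phi v).
Proof.
rewrite (@act_wide (size p).+1); last first.
  by have [->|p0] := eqVneq p 0; rewrite ?mul0r ?size_poly0 // size_mulX.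
rewrite big_ord_recl coefMX scale0r add0r; apply: eq_bigr => i _.
by rewrite coefMX /= -iterSr.
Qed.

Lemma actX v : act 'X v = phi v.
Proof. by rewrite -['X]mul1r actMX actC scale1r. Qed.

Lemma actMXn n p v : act (p * 'X^n) v = act p (iter n phi v).
Proof.
elim: n v => [|n IH] v; first by rewrite mulr1.
by rewrite exprSr mulrA actMX IH -iterSr.
Qed.

Lemma actXn n v : act 'X^n v = iter n phi v.
Proof. by rewrite -['X^n]mul1r actMXn actC scale1r. Qed.

Lemma semilin_act p v : phi (act p v) = act (map_poly s p) (phi v).
Proof.
rewrite semilin_sum (@act_wide (size p)) ?size_poly //.
by apply: eq_bigr => i _; rewrite phiZ coef_map -iterS iterSr.
Qed.

(** Makes V a left module over R[X, s]. Induction on p reduces this to X q = q^s X, which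
    [semilin_act] mirrors on V. *)
Lemma act_skew_mul p q v : act (skew_mul s p q) v = act p (act q v).
Proof.
elim/poly_ind: p q v => [|p c IH] q v.
  by rewrite -[0 : {poly R}]/(0%:P) skew_mulCl scale0r !act0l.
rewrite skew_mulDl skew_mulCl -{1}(skew_mulX s) -skew_mulA skew_mulXl.
by rewrite !actDl IH actMX -semilin_act actMX actZl actC.
Qed.

Lemma iter_semilin0 n : iter n phi 0 = 0.
Proof. by elim: n => //= n ->; rewrite semilin0. Qed.

Lemma iter_semilinD n : {morph iter n phi : u v / u + v}.
Proof. by elim: n => [|n IH] u v /=; rewrite ?IH ?phiD. Qed.

Lemma iter_semilinZ n c v : iter n phi (c *: v) = iter n s c *: iter n phi v.
Proof. by elim: n => //= n ->; rewrite phiZ. Qed.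

Lemma actDr p : {morph act p : u v / u + v}.
Proof.
move=> u v; rewrite -big_split; apply: eq_bigr => i _.
by rewrite iter_semilinD scalerDr.
Qed.

Lemma act0r p : act p 0 = 0.
Proof. by rewrite /act big1 // => i _; rewrite iter_semilin0 scaler0. Qed.

End SemilinearAction.

Section SemilinearPowers.

Variables (R : nzRingType) (s : {rmorphism R -> R}) (V : lmodType R).
Variable phi : V -> V.
Hypothesis phiD : {morph phi : u v / u + v}.
Hypothesis phiZ : forall c v, phi (c *: v) = s c *: phi v.
Implicit Types (p : {poly R}) (v : V).

Lemma iter_semilin_pow r j k v :
  iter k phi (iter j (iter r phi) v) = iter (k + j * r) phi v.
Proof. by rewrite iterD iterM. Qed.

(** phi^k commutes with phi^r, so only the coefficients change, by s^k. *)
Lemma iter_semilin_act_iter r k p v :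
  iter k phi (act (iter r phi) p v)
    = act (iter r phi) (map_poly (iter k s) p) (iter k phi v).
Proof.
rewrite (big_morph _ (iter_semilinD phiD k) (iter_semilin0 phiZ k)).
rewrite [RHS](@act_wide _ _ _ (size p)) ?size_poly //.
apply: eq_bigr => i _.
rewrite (iter_semilinZ phiZ) coef_map_id0 ?iter_rmorph0 //.
by rewrite iter_semilin_pow -iterM -iterD addnC.
Qed.

End SemilinearPowers.

(** Reads a polynomial in phi^n as the skew polynomial p(X^n), to which division in K[X, sigma]
    applies. *)
Lemma act_iter (R : comNzRingType) (V : lmodType R) (phi : V -> V) n
    (p : {poly R}) v :
  act (iter n phi) p v = act phi (p \Po 'X^n) v.
Proof.
elim/poly_ind: p v => [|p c IH] v; first by rewrite comp_poly0 !act0l.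
by rewrite comp_poly_MXaddC !actDl !actC actMX actMXn IH.
Qed.

Section LinearAction.

Variables (R : comNzRingType) (V : lmodType R) (f : V -> V).
Hypothesis fD : {morph f : u v / u + v}.
Hypothesis fZ : forall c v, f (c *: v) = c *: f v.

Lemma actM p q v : act f (p * q) v = act f p (act f q v).
Proof. by rewrite -skew_mul_id (@act_skew_mul _ idfun _ f fD fZ). Qed.

Lemma actZr c p v : act f p (c *: v) = c *: act f p v.
Proof. by rewrite -actZl -mul_polyC mulrC actM actC. Qed.

Lemma actr0 p : act f p 0 = 0.
Proof. by rewrite -[X in act f p X](scale0r 0) actZr scale0r. Qed.

Lemma act_dvdp (p q : {poly R}) v : act f p v = 0 ->
  act f (q * p) v = 0.
Proof. by move=> pv0; rewrite actM pv0 actr0. Qed.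

End LinearAction.

(** * Finite fields *)

(** The residue field is known only through its evaluation map [ev], which keeps later arguments
    free of the quotient construction. *)
Lemma finField_quotient (L : finFieldType) (Q : {poly L}) :
    monic_irreducible_poly Q ->
  exists (M : finFieldType) (ev : {rmorphism {poly L} -> M}),
    [/\ forall p, (ev p == 0) = (Q %| p), forall x, exists p, ev p = x
      & #|M| = (#|L| ^ (size Q).-1)%N].
Proof.
move=> Q_mi; pose M : finFieldType := {poly %/ Q with Q_mi}.
pose ev : {rmorphism {poly L} -> M} := GRing.RMorphism.clone _ _ (in_qpoly Q) _.
have evE p : val (ev p) = p %% Q.
  by rewrite /= Pdiv.IdomainMonic.modpE ?mk_monicE ?Q_mi.
exists M, ev; split=> [p | x | ]; last exact: card_qfpoly.
  by rewrite -val_eqE evE /dvdp.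
exists (val x); apply: val_inj; rewrite evE modp_small //.
by apply: leq_trans (size_mk_monic x) _; rewrite (mk_monicE Q_mi).
Qed.

Lemma monic_irreducible_factor (L : finFieldType) (p : {poly L}) :
  (1 < size p)%N -> exists2 Q, monic_irreducible_poly Q & Q %| p.
Proof.
have [n] := ubnP (size p); elim: n p => // n IH p lt_pn p_gt1.
have p_neq0 : p != 0 by rewrite -size_poly_gt0 ltnW.
have [p_irr | p_red] := boolP (irreducibleb p).
  have lc_p : (lead_coef p)^-1 != 0 by rewrite invr_eq0 lead_coef_eq0.
  exists ((lead_coef p)^-1 *: p); last by rewrite dvdpZl.
  split; last by rewrite monicE lead_coefZ mulVf // lead_coef_eq0.
  have /irreducibleP[_ p_dvd] := p_irr; split; first by rewrite size_scale.
  move=> q q_size; rewrite dvdpZr // => /(p_dvd q q_size) /eqp_trans-> //.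
  by rewrite eqp_sym eqp_scale.
move: p_red; rewrite /irreducibleb p_gt1 /= negb_forall => /existsP[q].
rewrite negb_imply -Pdiv.Idomain.dvdpE -ltnNge => /andP[q_dvd q_gt1].
(* [irreducibleb] ranges over polynomials of size at most [(size p).-1], whence the strict
   decrease. *)
have lt_qp : (size q < size p)%N.
  by rewrite (leq_ltn_trans (size_npoly q)) // prednK // ltnW.
have [Q Q_mi Q_dvd] := IH q (leq_trans lt_qp lt_pn) q_gt1.
by exists Q; rewrite // (dvdp_trans Q_dvd).
Qed.

(** The unit group is cyclic of order e k: if z = g^i and z^k = 1, then e k divides i k, so e
    divides i. *)
Lemma finField_expf_root (M : finFieldType) (z : M) (e k : nat) :
  #|M|.-1 = (e * k)%N -> z ^+ k = 1 -> exists u, u ^+ e = z.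
Proof.
move=> cardM zk1; have M_gt1 := finNzRing_gt1 M.
have ek_gt0 : (0 < e * k)%N by rewrite -cardM -subn1 subn_gt0.
have [e_gt0 k_gt0] : (0 < e)%N /\ (0 < k)%N by apply/andP; rewrite -muln_gt0.
have z_unit : z \is a GRing.unit.
  rewrite unitfE; apply: contra_eq_neq zk1 => ->.
  by rewrite expr0n gtn_eqF // eq_sym oner_eq0.
have /cyclicP[g g_gen] := field_unit_group_cyclic [set: {unit M}]%G.
have g_order : #[g]%g = (e * k)%N.
  by rewrite orderE -g_gen -cardM -card_finField_unit.
have /cyclePmin[i _ zE] : FinRing.unit M z_unit \in <[g]>%g.
  by rewrite -g_gen inE.
have /dvdnP[j iE] : (e %| i)%N.
  rewrite -(dvdn_pmul2r k_gt0) -g_order order_dvdn expgM -zE.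
  by apply/eqP/val_inj; rewrite FinRing.val_unitX.
exists (val (g ^+ j)%g).
by rewrite -FinRing.val_unitX -expgM -iE -zE.
Qed.

(** * Orbit of y under the q-power map *)

Section FrobeniusOrbit.

Variables (L : finFieldType) (q r : nat) (s : {rmorphism L -> L}).
Hypothesis sE : forall x, s x = x ^+ q.
Hypothesis cardL : #|L| = (q ^ r)%N.

Lemma iter_frobE i x : iter i s x = x ^+ (q ^ i).
Proof. by elim: i => [|i IH]; rewrite ?expr1 // iterS IH sE expnSr exprM. Qed.

Lemma frob_base_gt1 : (1 < q)%N.
Proof.
have := finNzRing_gt1 L; rewrite cardL; case: q => [|[]//].
  by case: r => // k; rewrite exp0n.
by rewrite exp1n.
Qed.

Lemma frob_degree_gt0 : (0 < r)%N.
Proof. by have := finNzRing_gt1 L; rewrite cardL; case: r. Qed.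

Lemma iter_frob_mul k x : iter (r * k) s x = x.
Proof.
rewrite iter_frobE expnM -cardL; elim: k => [|k IH]; first exact: expr1.
by rewrite expnSr exprM IH expf_card.
Qed.

Variables (M : finFieldType) (Q : {poly L}) (ev : {rmorphism {poly L} -> M}).
Hypothesis ev_eq0 : forall p, (ev p == 0) = (Q %| p).
Hypothesis ev_surj : forall x, exists p, ev p = x.
Hypothesis cardM : #|M| = (#|L| ^ (size Q).-1)%N.

Let m := (size Q).-1.
Let y := ev 'X.

(** The cardinal q^r of L is a power of the characteristic; as r > 0, so is q. *)
Lemma ev_powD i (a b : M) : (a + b) ^+ (q ^ i) = a ^+ (q ^ i) + b ^+ (q ^ i).
Proof.
have [p pr_p pcharL] := finPcharP L; apply: exprDn_pchar.
rewrite pnatX; apply/orP; left.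
have pcharM : p \in [pchar M].
  by apply: (rmorph_pchar ev); apply: (rmorph_pchar (@polyC L)).
rewrite (eq_pnat q (pcharf_eq pcharM)).
have := card_pprimeChar pcharL; rewrite [LHS]cardL => qr_pow.
have: p.-nat (q ^ r)%N by rewrite qr_pow pnatX pnat_id.
by rewrite pnatX eqn0Ngt frob_degree_gt0 orbF.
Qed.

(** Since y generates M over L, a power map that fixes y acts on coefficients only. *)
Lemma ev_frob i p : y ^+ (q ^ i) = y ->
  ev p ^+ (q ^ i) = ev (map_poly (iter i s) p).
Proof.
move=> yi; elim/poly_ind: p => [|p c IH].
  by rewrite map_poly0 !rmorph0 expr0n gtn_eqF // expn_gt0 ltnW ?frob_base_gt1.
have ->: map_poly (iter i s) (p * 'X + c%:P)
    = map_poly (iter i s) p * 'X + (iter i s c)%:P.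
  apply/polyP => k; rewrite coefD coefMX coefC coef_map_id0 ?iter_rmorph0 //.
  rewrite coefD coefMX coefC iter_rmorphD.
  by case: k => [|k] /=; rewrite ?coef_map_id0 ?iter_rmorph0.
rewrite !rmorphD !rmorphM /= -/y ev_powD exprMn yi IH iter_frobE.
by rewrite -!rmorphXn.
Qed.

(** r m is a period because M has q^(r m) elements; periods are closed under remainders, so the
    least one divides all others. *)
Lemma frob_period : exists2 n, (0 < n)%N & y ^+ (q ^ n) = y /\
  forall i, y ^+ (q ^ i) = y -> (n %| i)%N.
Proof.
pose per i := y ^+ (q ^ i) == y.
have perM i k : per i -> per (i * k)%N.
  move/eqP=> yi; rewrite /per expnM; elim: k => [|k IH]; first by rewrite expr1.
  by rewrite expnSr exprM (eqP IH) yi.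
have cardM' : #|M| = (q ^ (r * m))%N by rewrite cardM cardL expnM.
have ex_per : exists n, (0 < n)%N && per n.
  exists (r * m)%N; rewrite lt0n /per -cardM' expf_card eqxx andbT.
  by apply: contraTneq (finNzRing_gt1 M) => rm0; rewrite cardM' rm0.
case: (ex_minnP ex_per) => n /andP[n_gt0 per_n] n_min; exists n => //.
split=> [|i /eqP per_i]; first exact/eqP.
rewrite /dvdn -leqn0 leqNgt; apply/negP => in_gt0.
have: per (i %% n)%N.
  move: per_i; rewrite {1}(divn_eq i n) /per expnD exprM mulnC.
  by rewrite (eqP (perM n (i %/ n)%N per_n)).
move=> per_in; have := n_min _ (introT andP (conj in_gt0 per_in)).
by rewrite leqNgt ltn_pmod.
Qed.

Variable n : nat.
Hypothesis n_gt0 : (0 < n)%N.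
Hypothesis y_n : y ^+ (q ^ n) = y.
Hypothesis y_min : forall i, y ^+ (q ^ i) = y -> (n %| i)%N.

Let G := gcdn n r.
Let t := (r %/ G)%N.

(** Here n t = lcm(n, r). Both n and r divide r m. Conversely x -> x^(q^(n t)) fixes L and y, hence
    M, so the elements of M are roots of X^(q^(n t)) - X. *)
Lemma frob_lcm : (r * m = n * t)%N.
Proof.
have q_gt1 := frob_base_gt1.
have cardM' : #|M| = (q ^ (r * m))%N by rewrite cardM cardL expnM.
have nt : (n * t)%N = lcmn n r.
  by rewrite /lcmn muln_divA ?dvdn_gcdr.
apply/eqP; rewrite eqn_leq; apply/andP; split; last first.
  have rm_gt0 : (0 < r * m)%N.
    rewrite lt0n.
    by apply: contraTneq (finNzRing_gt1 M) => rm0; rewrite cardM' rm0.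
  rewrite dvdn_leq // nt dvdn_lcm (dvdn_mulr _ (dvdnn r)) andbT.
  by apply: y_min; rewrite -cardM' expf_card.
have [N rN] : exists N, (n * t = r * N)%N.
  by have /dvdnP[N lE] := dvdn_lcmr n r; exists N; rewrite nt lE mulnC.
have y_nt : y ^+ (q ^ (n * t)) = y.
  rewrite expnM; elim: {nt rN}t => [|k IH]; first by rewrite expr1.
  by rewrite expnSr exprM IH y_n.
have xnt (x : M) : x ^+ (q ^ (n * t)) = x.
  have [p <-] := ev_surj x; rewrite (ev_frob _ y_nt) rN; congr (ev _).
  apply/polyP => i; rewrite coef_map_id0 ?iter_rmorph0 //.
  exact: iter_frob_mul.
have qnt_gt1 : (1 < q ^ (n * t))%N.
  rewrite -(expn0 q) ltn_exp2l // muln_gt0 n_gt0 divn_gt0.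
    by rewrite dvdn_leq ?dvdn_gcdr ?frob_degree_gt0.
  by rewrite gcdn_gt0 n_gt0.
pose h : {poly M} := 'X^(q ^ (n * t)) - 'X.
have size_h : size h = (q ^ (n * t)).+1.
  by rewrite size_polyDl size_polyXn // size_polyN size_polyX.
have := @max_poly_roots _ h (enum M); rewrite -cardE size_h cardM' ltnS.
rewrite leq_exp2l //; apply; rewrite ?enum_uniq -?size_poly_gt0 ?size_h //.
by apply/allP => x _; rewrite rootE !hornerE xnt subrr.
Qed.

(** Identifies the number of vectors spanning the stable subspace with the orbit size. *)
Lemma frob_gcd : (G * m = n)%N.
Proof.
have G_gt0 : (0 < G)%N by rewrite gcdn_gt0 n_gt0.
have r_Gt : (r = t * G)%N by rewrite divnK ?dvdn_gcdr.
have t_gt0 : (0 < t)%N.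
  by move: frob_degree_gt0; rewrite r_Gt muln_gt0 => /andP[].
by apply/eqP; rewrite -(eqn_pmul2l t_gt0) mulnA -r_Gt frob_lcm mulnC.
Qed.

(** The coefficients of A are fixed by s, so the n conjugates of y are roots of A; they are distinct
    by minimality of n. *)
Lemma frob_orbit_size (A : {poly L}) : A != 0 -> map_poly s A = A -> Q %| A ->
  (n < size A)%N.
Proof.
move=> A_neq0 As QA; pose B := map_poly (ev \o polyC) A.
have evB p : ev p = (map_poly (ev \o polyC) p).[y].
  elim/poly_ind: p => [|p c IH]; first by rewrite !rmorph0 horner0.
  rewrite rmorphD rmorphM /= IH rmorphD rmorphM /= map_polyX map_polyC /=.
  by rewrite !hornerE.
have sA k j : iter k s A`_j = A`_j.
  by elim: k => //= k ->; rewrite -[in RHS]As coef_map.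
have root_y i : root B (y ^+ (q ^ i)).
  rewrite rootE; have -> : B.[y ^+ (q ^ i)] = B.[y] ^+ (q ^ i).
    have BE (x : M) : B.[x] = \sum_(j < size A) ev (A`_j)%:P * x ^+ j.
      by rewrite horner_poly.
    have pow_sum (I : finType) (E : I -> M) :
        (\sum_j E j) ^+ (q ^ i) = \sum_j E j ^+ (q ^ i).
      apply: (big_morph (fun x => x ^+ (q ^ i))); first exact: ev_powD.
      by rewrite expr0n gtn_eqF // expn_gt0 ltnW ?frob_base_gt1.
    rewrite !BE pow_sum; apply: eq_bigr => j _.
    rewrite exprMn exprAC; congr (_ * _); rewrite -!rmorphXn -iter_frobE /=.
    by rewrite sA.
  have /eqP evA0 : ev A == 0 by rewrite ev_eq0.
  by rewrite -evB evA0 expr0n gtn_eqF // expn_gt0 ltnW ?frob_base_gt1.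
rewrite -(size_map_poly (ev \o polyC)).
rewrite -[n](size_iota 0) -(size_map (fun i => y ^+ (q ^ i))).
apply: max_poly_roots; first by rewrite map_poly_eq0.
  by apply/allP => _ /mapP[i _ ->].
rewrite map_inj_in_uniq ?iota_uniq // => i j; rewrite !mem_iota !add0n /=.
wlog lt_ij : i j / (i < j)%N.
  move=> IH i_lt j_lt yij; case: (ltngtP i j) => // [lt|gt].
    exact: IH.
  by rewrite (IH j i).
move=> i_lt j_lt yij; have: (n %| j - i)%N.
  apply: y_min.
  (* The power q^(n - i) closes the orbit on the left and leaves y^(q^(j - i)) on the right. *)
  have : (y ^+ (q ^ i)) ^+ (q ^ (n - i)) = (y ^+ (q ^ j)) ^+ (q ^ (n - i)).
    by rewrite yij.
  rewrite -!exprM -!expnD subnKC ?(ltnW i_lt) // y_n.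
  rewrite addnBA ?(ltnW i_lt) // addnC -addnBA ?(ltnW lt_ij) //.
  by rewrite expnD exprM y_n => /esym.
by rewrite gtnNdvd ?subn_gt0 ?(leq_ltn_trans (leq_subr _ _)).
Qed.

(** The exponent is that of the norm to the field with q^n elements. Its product with q^n - 1 is the
    order of the unit group of M, and y^(n/G) is killed by q^n - 1. *)
Lemma frob_norm_surj : y != 0 ->
  exists u, u ^+ (\sum_(i < t) q ^ (n * i)) = y ^+ (n %/ G).
Proof.
move=> y_neq0; apply: (@finField_expf_root _ _ _ (q ^ n).-1).
  rewrite cardM cardL -expnM -/m frob_lcm [in LHS]expnM predn_exp mulnC.
  by congr (_ * _)%N; apply: eq_bigr => i _; rewrite expnM.
rewrite exprAC; suff -> : y ^+ (q ^ n).-1 = 1 by rewrite expr1n.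
apply: (mulfI y_neq0); rewrite -exprS prednK ?mulr1 //.
by rewrite expn_gt0 ltnW ?frob_base_gt1.
Qed.

End FrobeniusOrbit.

(** * A small stable subspace *)

Section CyclicDescent.

Variables (L : finFieldType) (q r d : nat) (s : {rmorphism L -> L}).
Hypothesis sE : forall x, s x = x ^+ q.
Hypothesis cardL : #|L| = (q ^ r)%N.

(** The sum is a trace: psi permutes its terms cyclically, because psi^t fixes w and, r dividing n
    t, commutes with c. The scalar c serves to make the trace nonzero. *)
Lemma semilin_fixed_vector (n : nat) (psi : 'rV[L]_d -> 'rV[L]_d) w :
    {morph psi : u v / u + v} ->
    (forall c v, psi (c *: v) = iter n s c *: psi v) ->
    (0 < n)%N -> w != 0 ->
    let t := (r %/ gcdn n r)%N in iter t psi w = w ->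
  exists2 c, \sum_(i < t) iter i psi (c *: w) != 0 &
    psi (\sum_(i < t) iter i psi (c *: w)) = \sum_(i < t) iter i psi (c *: w).
Proof.
move=> psiD psiZ n_gt0 w_neq0 t psi_t.
have r_gt0 := frob_degree_gt0 cardL; have q_gt1 := frob_base_gt1 cardL.
have t_gt0 : (0 < t)%N.
  by rewrite divn_gt0 ?gcdn_gt0 ?n_gt0 // dvdn_leq ?dvdn_gcdr.
have psi_iterZ i c v : iter i psi (c *: v) = iter (n * i) s c *: iter i psi v.
  elim: i => [|i IH] /=; first by rewrite muln0.
  by rewrite IH psiZ -iterD mulnS.
have nt : (n * t)%N = lcmn n r by rewrite /lcmn muln_divA ?dvdn_gcdr.
have [c Tc] : exists c, \sum_(i < t) iter i psi (c *: w) != 0.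
  apply/existsP; apply: contraNT w_neq0; rewrite negb_exists => /forallP T0.
  apply/eqP/rowP => j; rewrite mxE.
  (* Independence of the powers of s: reducing exponents mod r makes h a
     polynomial of degree < #|L| vanishing on L, with linear coefficient w_j. *)
  pose h := \sum_(i < t) (iter i psi w) 0 j *: 'X^(q ^ (n * i %% r)) : {poly L}.
  have h_eq0 : h = 0.
    apply: contraTeq (leqnn #|L|) => h_neq0; rewrite -ltnNge.
    have := @max_poly_roots _ h (enum L) h_neq0; rewrite -cardE enum_uniq.
    move=> lt_h; apply: leq_trans (lt_h _ isT) _.
      apply/allP => c _; rewrite rootE horner_sum; apply/eqP.
      have /eqP/rowP/(_ j) := negbNE (T0 c); rewrite summxE mxE => {2}<-.
      apply: eq_bigr => i _; rewrite hornerZ hornerXn psi_iterZ mxE mulrC.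
      congr (_ * _); rewrite [in RHS](divn_eq (n * i) r) addnC iterD.
      rewrite [(_ %/ r * r)%N]mulnC.
      by rewrite (iter_frob_mul sE cardL) (iter_frobE sE).
    apply: (leq_trans (size_sum _ _ _)); apply/bigmax_leqP => i _.
    apply: (leq_trans (size_scale_leq _ _)); rewrite size_polyXn cardL.
    by rewrite ltn_exp2l // ltn_pmod.
  (* Only i = 0 contributes to the coefficient of X: if r divides n i, then so does lcm(n, r) = n t,
     which forces i = 0 as i < t. *)
  have := congr1 (fun p : {poly L} => p`_1) h_eq0; rewrite coef0 coef_sum.
  rewrite (bigD1 (Ordinal t_gt0)) //= muln0 mod0n expn0 coefZ coefXn eqxx mulr1.
  rewrite big1 ?addr0 // => i i_neq0; rewrite coefZ coefXn.
  rewrite -[X in X == _](expn0 q) eqn_exp2l //.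
  case: eqP => ni0; last by rewrite mulr0.
  case/negP: i_neq0; rewrite -val_eqE /=.
  have: (n * t %| n * i)%N by rewrite nt dvdn_lcm dvdn_mulr //= /dvdn ni0.
  rewrite dvdn_pmul2l //; case: (posnP i) => // i_gt0 /(dvdn_leq i_gt0).
  by rewrite leqNgt ltn_ord.
exists c; first exact: Tc.
have psi0 : psi 0 = 0.
  have := psiZ 0 0; rewrite !scale0r => ->.
  by rewrite iter_rmorph0 scale0r.
rewrite (big_morph psi psiD psi0).
case: t t_gt0 {Tc} psi_t nt => // t _ psi_t nt.
rewrite big_ord_recr [RHS]big_ord_recl /= addrC; congr (_ + _).
rewrite -iterS psi_iterZ psi_t nt.
by have /dvdnP[N ->] := dvdn_lcmr n r; rewrite mulnC (iter_frob_mul sE cardL).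
Qed.

End CyclicDescent.

Section StableSubspace.

Variables (L : finFieldType) (q r d : nat) (s : {rmorphism L -> L}).
Hypothesis sE : forall x, s x = x ^+ q.
Hypothesis cardL : #|L| = (q ^ r)%N.
Variable phi : 'rV[L]_d -> 'rV[L]_d.
Hypothesis phiD : {morph phi : u v / u + v}.
Hypothesis phiZ : forall c v, phi (c *: v) = s c *: phi v.
Implicit Types (p A Q : {poly L}) (u v w : 'rV[L]_d).

Let f := iter r phi.

Lemma pow_semilinD : {morph f : u v / u + v}.
Proof. exact: iter_semilinD. Qed.

Lemma pow_semilinZ c v : f (c *: v) = c *: f v.
Proof.
by rewrite /f (iter_semilinZ phiZ) -[r]muln1 (iter_frob_mul sE cardL).
Qed.

Let fD := pow_semilinD.
Let fZ := pow_semilinZ.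

Lemma stable_subspace_of_kernel v : phi v = 0 ->
  forall u, (u <= v)%MS -> (phi u <= v)%MS.
Proof. by move=> v0 u /sub_rVP[c ->]; rewrite phiZ v0 scaler0 sub0mx. Qed.

(** The size k of W is bounded through the polynomials A it will be compared with, so that the orbit
    size n stays internal to the proof. *)
Lemma stable_subspace (Q : {poly L}) w :
    monic_irreducible_poly Q -> ~~ (Q %| 'X) -> w != 0 -> act f Q w = 0 ->
  exists k (W : 'M[L]_(k, d)),
    [/\ exists2 v : 'rV[L]_d, v != 0 & (v <= W)%MS,
        forall u : 'rV[L]_d, (u <= W)%MS -> (phi u <= W)%MS
      & forall A, A != 0 -> map_poly s A = A -> Q %| A -> (k < size A)%N].
Proof.
move=> Q_mi ndvd_QX w_neq0 Qw.
have [M [ev [ev_eq0 ev_surj cardM]]] := finField_quotient Q_mi.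
pose y := ev 'X; have y_neq0 : y != 0 by rewrite ev_eq0.
have [n n_gt0 [y_n y_min]] := frob_period cardL ev cardM.
have frobG := frob_gcd sE cardL ev_surj cardM n_gt0 y_n y_min.
have [u uE] := frob_norm_surj sE cardL ev_surj cardM n_gt0 y_n y_min y_neq0.
have orbit := frob_orbit_size sE cardL ev_eq0 y_n y_min.
set G := gcdn n r in frobG uE; set t := (r %/ G)%N in uE.
set m := (size Q).-1 in frobG.
have ev_frob_n p : ev p ^+ (q ^ n) = ev (map_poly (iter n s) p).
  exact: (ev_frob sE cardL).
have q_gt1 := frob_base_gt1 cardL.
have G_gt0 : (0 < G)%N by rewrite gcdn_gt0 n_gt0.
have r_gt0 := frob_degree_gt0 cardL.
pose V1 v := act f Q v = 0.
(* On V_1 the action of p(f) depends only on the class of p in M: V_1 is an M-vector space. *)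
have actE p p' v : V1 v -> ev p = ev p' -> act f p v = act f p' v.
  move=> v1 /eqP; rewrite -subr_eq0 -rmorphB /= ev_eq0 => /dvdpP[h pE].
  by apply/eqP; rewrite -subr_eq0 -actBl pE (act_dvdp fD fZ _ v1).
have V1act p v : V1 v -> V1 (act f p v).
  by move=> v1; rewrite /V1 -(actM fD fZ) mulrC (act_dvdp fD fZ _ v1).
have V1D v v' : V1 v -> V1 v' -> V1 (v + v').
  by rewrite /V1 (actDr fD) => -> ->; rewrite addr0.
have y_pow k : y ^+ (q ^ (n * k)) = y.
  by rewrite expnM; elim: k => [|k IH]; rewrite ?expr1 // expnSr exprM IH y_n.
(* Hence phi^(n t) = f^(n/G), which is multiplication by y^(n/G) on V_1. *)
have nt : (n * t = n %/ G * r)%N.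
  by rewrite muln_divA ?dvdn_gcdr // mulnC -muln_divA ?dvdn_gcdl // mulnC.
have t_gt0 : (0 < t)%N by rewrite divn_gt0 // dvdn_leq ?dvdn_gcdr.
have V1phi v : V1 v -> V1 (iter n phi v).
  (* Q0 is sent to Q by s^n and is divisible by Q, as the q^n-power map of M
     fixes y and so acts on coefficients only. *)
  move=> v1; pose Q0 := map_poly (iter (n * t.-1) s) Q.
  have Q0v : act f Q0 v = 0.
    rewrite (actE _ 0 v v1) ?act0l // -(ev_frob sE cardL _ (y_pow _)) rmorph0.
    have /eqP-> : ev Q == 0 by rewrite ev_eq0.
    by rewrite expr0n gtn_eqF // expn_gt0 ltnW.
  have := congr1 (iter n phi) Q0v; rewrite (iter_semilin_act_iter phiD phiZ).
  rewrite /V1 (iter_semilin0 phiZ) => <-; congr (act f _ _); apply/polyP => i.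
  rewrite !coef_map_id0 ?iter_rmorph0 // -iterD -mulnS prednK // nt mulnC.
  by rewrite (iter_frob_mul sE cardL).
have u_neq0 : u != 0.
  apply: contraTneq (expf_neq0 (n %/ G) y_neq0) => u0; rewrite -uE u0.
  by rewrite expr0n (bigD1 (Ordinal t_gt0)) //= muln0 expn0 eqxx.
have [U Uu] := ev_surj u; have [U' U'u] := ev_surj u^-1.
(* On V_1 this is u^-1 phi^n. *)
pose psi v := act f U' (iter n phi v).
have psiD : {morph psi : a b / a + b}.
  by move=> a b; rewrite /psi (iter_semilinD phiD) (actDr fD).
have psiZ c v : psi (c *: v) = iter n s c *: psi v.
  by rewrite /psi (iter_semilinZ phiZ) (actZr fD fZ).
have V1psi v : V1 v -> V1 (psi v) by move=> /V1phi; apply: V1act.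
(* Each passage of phi^n across a power of u^-1 raises it to the power q^n; for i = t the exponents
   add up to the norm. *)
have psi_iter i : exists2 Ui, ev Ui = u^-1 ^+ (\sum_(k < i) q ^ (n * k)) &
    iter i psi w = act f Ui (iter (n * i) phi w).
  elim: i => [|i [Ui Ui_u IH]].
    by exists 1; rewrite ?rmorph1 ?big_ord0 // muln0 actC scale1r.
  exists (U' * map_poly (iter n s) Ui).
    rewrite rmorphM /= -ev_frob_n Ui_u U'u big_ord_recl muln0 expn0 exprS.
    rewrite -exprM; congr (_ * _ ^+ _); rewrite big_distrl.
    by apply: eq_bigr => k _; rewrite /= -expnD mulnS addnC.
  rewrite /= IH /psi (iter_semilin_act_iter phiD phiZ) (actM fD fZ).
  by rewrite mulnS iterD.
have psi_t : iter t psi w = w.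
  have [Ut Ut_u ->] := psi_iter t.
  rewrite nt iterM -/f -actXn -(actM fD fZ) (actE _ 1) ?actC ?scale1r //.
  rewrite rmorphM rmorphXn /= -/y Ut_u -uE -exprMn mulVf // expr1n.
  by rewrite rmorph1.
have [c v_neq0 psi_v] :=
  semilin_fixed_vector sE cardL psiD psiZ n_gt0 w_neq0 psi_t.
set v := \sum_(i < _) _ in v_neq0 psi_v.
have V1v : V1 v.
  apply: (big_ind V1) => [|//|i _]; first exact: (actr0 fD fZ).
  elim: (nat_of_ord i) => [|k IH] /=; last exact: V1psi.
  by rewrite /V1 (actZr fD fZ) Qw scaler0.
clearbody v.
have phi_n : iter n phi v = act f U v.
  rewrite -[in RHS]psi_v -(actM fD fZ) (actE _ 1) ?actC ?scale1r //.
    exact: V1phi.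
  by rewrite rmorphM /= Uu U'u mulfV // rmorph1.
have phi_nk k : exists B, iter (n * k) phi v = act f B v.
  elim: k => [|k [B IH]]; first by exists 1; rewrite muln0 actC scale1r.
  exists (map_poly (iter n s) B * U).
  rewrite mulnS iterD IH (iter_semilin_act_iter phiD phiZ) phi_n.
  by rewrite (actM fD fZ).
(* Bezout gives kn n = kr r + G. Writing v as f^kr (y^-kr v) turns phi^G v into phi^(n kn) (y^-kr
   v), which lies in M v. *)
have [B phi_G] : exists B, iter G phi v = act f B v.
  have [kn kr bezout _] := egcdnP r n_gt0.
  have [Y Yy] := ev_surj (y ^- kr); have [B phi_kn] := phi_nk kn.
  have vE : v = iter kr f (act f Y v).
    rewrite -actXn -(actM fD fZ) (actE _ 1) ?actC ?scale1r //.
    by rewrite rmorphM rmorphXn /= Yy mulfV ?expf_neq0 // rmorph1.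
  exists (map_poly (iter (n * kn) s) Y * B).
  rewrite [in LHS]vE iter_semilin_pow addnC -bezout mulnC.
  by rewrite (iter_semilin_act_iter phiD phiZ) phi_kn (actM fD fZ).
(* Row j * G + i is phi^i (y^j v). *)
pose W : 'M_(G * m, d) :=
  \matrix_(k < G * m) iter (k %% G + k %/ G * r) phi v.
(* Reducing p modulo Q leaves m coefficients, which match the rows of W. *)
have memW i p : (i < G)%N -> (iter i phi (act f p v) <= W)%MS.
  move=> lt_iG; have -> : act f p v = act f (p %% Q) v.
    apply: actE => //; apply/eqP; rewrite -subr_eq0 -rmorphB /= ev_eq0.
    by rewrite {1}(divp_eq p Q) addrK dvdp_mull.
  have Q_neq0 : Q != 0 by rewrite monic_neq0 ?Q_mi.
  have le_m : (size (p %% Q)%R <= m)%N.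
    by rewrite -ltnS prednK ?ltn_modp // size_poly_gt0.
  rewrite (act_wide _ _ le_m).
  rewrite (big_morph _ (iter_semilinD phiD i) (iter_semilin0 phiZ i)).
  apply: summx_sub => j _; rewrite (iter_semilinZ phiZ) iter_semilin_pow.
  apply: scalemx_sub; have lt_k : (j * G + i < G * m)%N.
    rewrite (@leq_trans (j.+1 * G)%N) //; first by rewrite mulSnr ltn_add2l.
    by rewrite [(G * m)%N]mulnC leq_mul.
  suff -> : iter (i + j * r) phi v = row (Ordinal lt_k) W by apply: row_sub.
  by rewrite rowK /= modnMDl modn_small // divnMDl // divn_small // addn0.
exists (G * m)%N, W; split; first exists v => //.
- by have := memW 0%N 1 G_gt0; rewrite actC scale1r.
- move=> x /submxP[D ->]; rewrite mulmx_sum_row (semilin_sum phiD phiZ).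
  apply: summx_sub => k _; rewrite phiZ rowK scalemx_sub //.
  rewrite -iter_semilin_pow -(actXn f) -iterS.
  have := ltn_pmod k G_gt0.
  (* Applying phi raises i by one; when it reaches G, [phi_G] brings the vector back into M v. *)
  rewrite leq_eqVlt => /predU1P[->|]; last exact: memW.
  rewrite (iter_semilin_act_iter phiD phiZ) phi_G -(actM fD fZ).
  exact: (memW 0%N).
- by rewrite frobG.
Qed.

End StableSubspace.

(** Subspaces are predicates on V, so kernels of operators can be used directly. The zero space also
    qualifies, and is excluded later by 0 < d. *)
Definition simple_semilin (R : nzRingType) (V : lmodType R) (phi : V -> V) :=
  forall U : V -> Prop,
    (forall u v, U u -> U v -> U (u + v)) ->
    (forall c u, U u -> U (c *: u)) ->
    (forall u, U u -> U (phi u)) ->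
  forall v, v != 0 -> U v -> forall w, U w.

(** Strip an irreducible factor Q from p = h Q: either Q(f) kills w, or Q(f) w is a nonzero vector
    killed by h(f). *)
Lemma irreducible_kernel (L : finFieldType) (V : lmodType L) (f : V -> V)
    (p : {poly L}) w :
    {morph f : u v / u + v} -> (forall c v, f (c *: v) = c *: f v) ->
    p != 0 -> w != 0 -> act f p w = 0 ->
  exists Q v, [/\ monic_irreducible_poly Q, v != 0 & act f Q v = 0].
Proof.
move=> fD fZ; have [n] := ubnP (size p).
elim: n p w => // n IH p w lt_pn p_neq0 w_neq0 pw.
have p_gt1 : (1 < size p)%N.
  rewrite ltnNge; apply: contra_neqN w_neq0 => /size1_polyC pC.
  move: pw p_neq0; rewrite pC actC polyC_eq0 => /eqP.
  by rewrite scaler_eq0 => /orP[->|/eqP].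
have [Q Q_mi /dvdpP[h ph]] := monic_irreducible_factor p_gt1.
have [Qw | Qw] := eqVneq (act f Q w) 0; first by exists Q, w.
have h_neq0 : h != 0 by apply: contraNneq p_neq0 => h0; rewrite ph h0 mul0r.
apply: (IH h (act f Q w)) => //; last by rewrite -(actM fD fZ) -ph.
apply: leq_trans _ (_ : size p <= n)%N; last by rewrite -ltnS.
have [[Q_gt1 _] _] := Q_mi.
rewrite ph size_mul ?(monic_neq0 (snd Q_mi)) //.
by case: (size Q) Q_gt1 => [|[|k]] // _; rewrite !addnS /= ltnS leq_addr.
Qed.

(** By simplicity the rows of the stable W span everything, so their number is at least d. *)
Lemma simple_semilin_size (L : finFieldType) (q r d : nat)
    (s : {rmorphism L -> L}) (phi : 'rV[L]_d -> 'rV[L]_d) (A : {poly L}) :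
    (forall x, s x = x ^+ q) -> #|L| = (q ^ r)%N ->
    {morph phi : u v / u + v} -> (forall c v, phi (c *: v) = s c *: phi v) ->
    simple_semilin phi -> (0 < d)%N -> A != 0 -> map_poly s A = A ->
    (forall v, act (iter r phi) A v = 0) ->
  (d < size A)%N.
Proof.
move=> sE cardL phiD phiZ phi_simple d_gt0 A_neq0 As Af.
have fD := pow_semilinD r phiD; have fZ := pow_semilinZ sE cardL phiZ.
pose e0 : 'rV[L]_d := delta_mx 0 (Ordinal d_gt0).
have e0_neq0 : e0 != 0.
  apply/eqP => /rowP/(_ (Ordinal d_gt0)); rewrite !mxE !eqxx => /eqP.
  by rewrite oner_eq0.
have dim_stable k (W : 'M[L]_(k, d)) :
    (exists2 v : 'rV[L]_d, v != 0 & (v <= W)%MS) ->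
    (forall u : 'rV[L]_d, (u <= W)%MS -> (phi u <= W)%MS) -> (d <= k)%N.
  move=> [v v_neq0 vW] W_stable.
  have W_full (w : 'rV[L]_d) : (w <= W)%MS.
    apply: (phi_simple (fun u => (u <= W)%MS)) v_neq0 vW w => //.
    - by move=> u v' uW v'W; apply: addmx_sub.
    - by move=> c u uW; apply: scalemx_sub.
  rewrite -[d](mxrank1 L); apply: leq_trans (rank_leq_row W).
  by apply/mxrankS/row_subP => i; apply: W_full.
have [Q [w [Q_mi w_neq0 Qw]]] :=
  irreducible_kernel fD fZ A_neq0 e0_neq0 (Af e0).
have QA : Q %| A.
  apply: contraT => ndvd_QA; case/negP: w_neq0.
  have := irreducible_poly_coprime A (fst Q_mi); rewrite (negPf ndvd_QA) /=.
  move/Bezout_eq1_coprimepP => [[a b] /= ab1].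
  rewrite -[w]scale1r -(actC (iter r phi)) polyC1 -ab1 actDl.
  by rewrite !(actM fD fZ) Qw Af !(actr0 fD fZ) addr0.
have [QX | ndvd_QX] := boolP (Q %| 'X); last first.
  have [k [W [W_neq0 W_stable]]] :=
    stable_subspace sE cardL phiD phiZ Q_mi ndvd_QX w_neq0 Qw.
  by move/(_ A A_neq0 As QA); apply: leq_ltn_trans (dim_stable k W W_neq0 _).
have fw : iter r phi w = 0.
  by rewrite -actX; have /dvdpP[h ->] := QX; rewrite (act_dvdp fD fZ).
(* The last nonzero iterate of w under phi. *)
have [v v_neq0 v0] : exists2 v, v != 0 & phi v = 0.
  elim: r fw {cardL Af fD fZ Qw} => [|k IH] /= fw.
    by rewrite fw eqxx in w_neq0.
  have [/IH // | kw] := eqVneq (iter k phi w) 0.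
  by exists (iter k phi w).
apply: (@leq_ltn_trans 1%N).
  apply: (dim_stable 1%N v); first by exists v.
  exact: (stable_subspace_of_kernel phiZ v0).
rewrite ltnNge; apply: contra_neqN e0_neq0 => /size1_polyC AC.
have := Af e0; rewrite AC actC => /eqP.
rewrite scaler_eq0 => /orP[/eqP c0|/eqP //].
by case/negP: A_neq0; rewrite AC c0.
Qed.

(** Transfers the bound to K, which becomes a finite field as [finvect_type K]. *)
Lemma simple_semilin_size_ext (F : finFieldType) (K : fieldExtType F) (d : nat)
    (phi : 'rV[K]_d -> 'rV[K]_d) (A : {poly K}) :
    {morph phi : u v / u + v} ->
    (forall c v, phi (c *: v) = sigma K c *: phi v) ->
    simple_semilin phi -> (0 < d)%N -> A != 0 -> map_poly (sigma K) A = A ->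
    (forall v, act (iter (\dim {:K}) phi) A v = 0) ->
  (d < size A)%N.
Proof.
have cardK : #|finvect_type K| = (#|F| ^ \dim {:K})%N.
  rewrite -(card_vspacef (Vector.class (finvect_type K : vectType F))).
  exact: card_vspace.
exact: (@simple_semilin_size (finvect_type K) _ _ d (sigma K) phi A
  (@sigmaE F K) cardK).
Qed.

(** * Skew polynomials and the module D_P *)

Section SkewDivision.

Variables (K : fieldType) (s : {rmorphism K -> K}).
Implicit Types p q R : {poly K}.

Lemma iter_fmorph_eq0 n x : (iter n s x == 0) = (x == 0).
Proof. by elim: n => //= n IH; rewrite fmorph_eq0. Qed.

Lemma coef_skew_mul_lead p q :
  (skew_mul s p q)`_((size p).-1 + (size q).-1)
    = lead_coef p * iter (size p).-1 s (lead_coef q).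
Proof.
have lt_p : ((size p).-1 < ((size p).-1 + (size q).-1).+1)%N.
  by rewrite ltnS leq_addr.
rewrite coef_skew_mul.
rewrite (bigD1 (Ordinal lt_p)) //= addKn big1 ?addr0 // => i.
rewrite -val_eqE /= neq_ltn => /orP[lt_ip | gt_ip].
  rewrite [q`__]nth_default ?iter_rmorph0 ?mulr0 //.
  rewrite leq_subRL ?leq_ord //.
  rewrite (@leq_trans (i.+1 + (size q).-1)) ?leq_add2r //.
  by rewrite addSnnS leq_add2l leqSpred.
by rewrite nth_default ?mul0r // (leq_trans (leqSpred _)).
Qed.

(** s is injective on a field, so the twisted product of the leading coefficients is nonzero. *)
Lemma size_skew_mul p q : p != 0 -> q != 0 ->
  size (skew_mul s p q) = (size p + size q).-1.
Proof.
move=> p_neq0 q_neq0; apply/eqP; rewrite eqn_leq size_poly /=.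
have : (skew_mul s p q)`_((size p).-1 + (size q).-1) != 0.
  by rewrite coef_skew_mul_lead mulf_neq0 ?iter_fmorph_eq0 ?lead_coef_eq0.
move/(contra_neqN (@nth_default _ 0 _ _)); rewrite -ltnNge.
case: (size p) (size_poly_eq0 p) => [/esym|a _].
  by rewrite (negPf p_neq0).
case: (size q) (size_poly_eq0 q) => [/esym|b _].
  by rewrite (negPf q_neq0).
by rewrite /= addnS.
Qed.

Lemma skew_mulZXn c n p :
  skew_mul s (c *: 'X^n) p = c *: (map_poly (iter n s) p * 'X^n).
Proof.
apply/polyP => k; rewrite coef_skew_mul coefZ coefMXn.
have [lt_kn | le_nk] := ltnP k n.
  rewrite big1 ?mulr0 // => i _; rewrite coefZ coefXn.
  by rewrite ltn_eqF ?mulr0 ?mul0r // (leq_trans (ltn_ord i)).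
have lt_n : (n < k.+1)%N by [].
rewrite (bigD1 (Ordinal lt_n)) //= big1 ?addr0 => [|i].
  by rewrite coefZ coefXn eqxx mulr1 coef_map_id0 ?iter_rmorph0.
by rewrite -val_eqE coefZ coefXn => /negPf /= ->; rewrite mulr0 mul0r.
Qed.

(** Division with the divisor on the right: X^k twists the leading coefficient of R by s^k, hence
    the denominator of [c]. *)
Lemma skew_divp p R : R != 0 ->
  exists S T, p = skew_mul s S R + T /\ (size T < size R)%N.
Proof.
move=> R_neq0; have [n] := ubnP (size p); elim: n p => // n IH p lt_pn.
have [lt_pR | le_Rp] := ltnP (size p) (size R).
  by exists 0, p; rewrite -[0 : {poly K}]/(0%:P) skew_mulCl scale0r add0r.
pose k := (size p - size R)%N.
pose c := lead_coef p / iter k s (lead_coef R).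
pose p' := p - skew_mul s (c *: 'X^k) R.
have R_gt0 : (0 < size R)%N by rewrite size_poly_gt0.
have size_p' : (size p' < size p)%N.
  have p_gt0 := leq_trans R_gt0 le_Rp.
  rewrite -(prednK p_gt0) ltnS; apply/leq_sizeP => j le_j.
  rewrite coefB skew_mulZXn coefZ coefMXn coef_map_id0 ?iter_rmorph0 //.
  have le_kj : (k <= j)%N.
    apply: leq_trans le_j; rewrite /k -subn1 leq_sub2l //.
  rewrite ltnNge le_kj /=; move: le_j; rewrite leq_eqVlt => /predU1P[<-|lt_j].
    have -> : ((size p).-1 - k = (size R).-1)%N.
      by rewrite /k -!subn1 subnAC subKn.
    rewrite -/(lead_coef p) -/(lead_coef R) /c divfK ?subrr //.
    by rewrite iter_fmorph_eq0 lead_coef_eq0.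
  rewrite (prednK p_gt0) in lt_j.
  rewrite !nth_default ?iter_rmorph0 ?mulr0 ?subrr //.
  by rewrite leq_subRL // /k subnK.
have [S [T [p'E T_lt]]] := IH p' (leq_trans size_p' lt_pn).
exists (c *: 'X^k + S), T; split=> //.
by rewrite skew_mulDl -addrA -p'E addrC subrK.
Qed.

End SkewDivision.

(** The case d = 0 is apart because [horner_mx] takes matrices of nonzero size. *)
Lemma Cayley_Hamilton_act (K : comNzRingType) d (f : 'rV[K]_d -> 'rV[K]_d) :
    {morph f : u v / u + v} -> (forall c v, f (c *: v) = c *: f v) ->
  forall v, act f (char_poly (lin1_mx f)) v = 0.
Proof.
case: d f => [|d] f fD fZ v; first by apply/rowP => -[].
set N := lin1_mx f.
have fN u : f u = u *m N.
  rewrite {1}(row_sum_delta u) (semilin_sum (s := idfun) fD fZ) mulmx_sum_row.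
  apply: eq_bigr => i _; rewrite fZ; congr (_ *: _).
  by apply/rowP => j; rewrite !mxE.
suff actN p u : act f p u = u *m horner_mx N p.
  by rewrite actN Cayley_Hamilton mulmx0.
elim/poly_ind: p u => [|p c IH] u; first by rewrite act0l rmorph0 mulmx0.
rewrite actDl actMX actC IH fN [p * _]mulrC rmorphD rmorphM /= horner_mx_X.
by rewrite horner_mx_C mulmxDr mul_mx_scalar -mulmxA.
Qed.

Section CyclicVector.

Variables (F : finFieldType) (K : fieldExtType F) (P : skewpoly (sigma K)).
Hypothesis P_monic : (P : {poly K}) \is monic.

Let d := (size P).-1.
(** The basis vector e_0, in a form that also makes sense for d = 0. *)
Let e0 : 'rV[K]_d := poly_rV 1.

Lemma size_monic_skew : size P = d.+1.
Proof. by rewrite prednK // size_poly_gt0 monic_neq0. Qed.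

Lemma iter_phi_poly_rV1 i (lt_id : (i < d)%N) :
  iter i (phi P) e0 = delta_mx 0 (Ordinal lt_id).
Proof.
elim: i lt_id => [|i IH] lt_id /=.
  by apply/rowP => j; rewrite !mxE coef1 -val_eqE.
by rewrite (IH (ltnW lt_id)) phi_delta; congr delta_mx; apply: val_inj.
Qed.

(** Identifies D_P with the remainders of right division by P. *)
Lemma act_phi_poly_rV (p : {poly K}) : (size p <= d)%N ->
  act (phi P) p e0 = poly_rV p.
Proof.
move=> le_pd; rewrite (act_wide _ _ le_pd) (row_sum_delta (poly_rV p)).
apply: eq_bigr => i _; rewrite iter_phi_poly_rV1 mxE.
by congr (_ *: delta_mx _ _); apply: val_inj.
Qed.

Lemma act_phi_rVpoly (v : 'rV[K]_d) : act (phi P) (rVpoly v) e0 = v.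
Proof. by rewrite act_phi_poly_rV ?size_poly // rVpolyK. Qed.

Lemma act_phi_annihilator : act (phi P) P e0 = 0.
Proof.
have [d0 | d_gt0] := posnP d; first apply/rowP => j.
  suff: (0 < d)%N by rewrite d0.
  exact: leq_ltn_trans (ltn_ord j).
rewrite (@act_wide _ _ _ d.+1) ?size_monic_skew // big_ord_recr /=.
have lc : P`_d = 1 := monicP P_monic.
have lt_d : (d.-1 < d)%N by rewrite prednK.
have -> : iter d (phi P) e0 = \sum_(j < d) - P`_j *: delta_mx 0 j.
  rewrite -[in LHS](prednK d_gt0) iterS (iter_phi_poly_rV1 lt_d).
  by rewrite phi_delta_last.
rewrite lc scale1r -big_split big1 // => i _; rewrite iter_phi_poly_rV1 scaleNr.
apply/eqP; rewrite subr_eq0; apply/eqP.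
by congr (_ *: delta_mx _ _); apply: val_inj.
Qed.

End CyclicVector.

Section SkewUnits.

Variables (K : fieldType) (s : {rmorphism K -> K}).
Implicit Type p : skewpoly s.

Lemma skew_mulE (p q : skewpoly s) : p * q = skew_mul s p q.
Proof. by []. Qed.

Lemma skew_unit_size p : is_unit p <-> size p = 1%N.
Proof.
split=> [[t [tp1 _]] | /eqP/size_poly1P[c c_neq0 ->]].
  have sz1 : size (skew_mul s t p) = 1%N by rewrite -skew_mulE tp1 size_poly1.
  have t_neq0 : t != 0 :> {poly K}.
    apply/eqP => t0; move: tp1; rewrite t0 mul0r => /eqP.
    by rewrite eq_sym oner_eq0.
  have p_neq0 : p != 0 :> {poly K}.
    apply/eqP => p0; move: tp1; rewrite p0 mulr0 => /eqP.
    by rewrite eq_sym oner_eq0.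
  move: sz1; rewrite size_skew_mul //.
  case: (size t) (size_poly_eq0 t) => [/esym|a _].
    by rewrite (negPf t_neq0).
  case: (size p) (size_poly_eq0 p) => [/esym|b _].
    by rewrite (negPf p_neq0).
  by rewrite addSn addnS /= => -[/eqP]; rewrite addn_eq0 => /andP[_ /eqP->].
exists (c^-1)%:P; rewrite !skew_mulE !skew_mulCl -!mul_polyC -!polyCM.
by rewrite mulVf // mulfV.
Qed.

End SkewUnits.

(** * The two implications *)

Section Irreducibility.

Variables (F : finFieldType) (K : fieldExtType F).
Implicit Type P : skewpoly (sigma K).

Lemma size_Psi P : size (Psi P) = (size P).-1.+1.
Proof. by rewrite -(size_map_poly (in_alg K)) map_Psi size_char_poly. Qed.

Lemma act_PsiK P v : act (iter (\dim {:K}) (phi P)) (PsiK P) v = 0.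
Proof. exact: (Cayley_Hamilton_act (@phi_iterD _ _ P) (@phi_iterZ _ _ P)). Qed.

Lemma skew_annihilator P (p : {poly K}) : (P : {poly K}) \is monic ->
    act (phi P) p (poly_rV 1) = 0 ->
  exists T, p = skew_mul (sigma K) T P.
Proof.
move=> P_monic.
have [T [t [-> lt_t]]] := skew_divp (sigma K) p (monic_neq0 P_monic).
rewrite actDl (act_skew_mul (@phiD _ _ P) (@phiZ _ _ P)) act_phi_annihilator //.
have t_le : (size t <= (size P).-1)%N by rewrite -ltnS -size_monic_skew.
rewrite (act0r (@phiZ _ _ P)) add0r act_phi_poly_rV // => t0; exists T.
by rewrite -(poly_rV_K t_le) t0 linear0 addr0.
Qed.

(** Descent on the degree of a nonzero R with R e_0 in U: the remainder of P by R also sends e_0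
    into U, since P e_0 = 0. At the end R divides P on the right. *)
Lemma phi_simple P : (P : {poly K}) \is monic -> irreducible P ->
  simple_semilin (phi P).
Proof.
move=> P_monic [_ _ P_irr] U UD UZ Uphi v v_neq0 Uv w.
have D := @phiD _ _ P; have Z := @phiZ _ _ P.
pose e0 : 'rV[K]_(size P).-1 := poly_rV 1.
have U0 : U 0 by rewrite -(scale0r v); apply: UZ.
have Uact p u : U u -> U (act (phi P) p u).
  move=> Uu; apply: (big_ind U) => // i _; apply: UZ.
  by elim: (nat_of_ord i) => //= k; apply: Uphi.
suff Ue0 : U e0 by rewrite -(act_phi_rVpoly w); apply: Uact.
have [n] := ubnP (size (rVpoly v)).
have := size_poly _ _ : (size (rVpoly v) <= (size P).-1)%N.
have : rVpoly v != 0.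
  by apply: contraNneq v_neq0 => v0; rewrite -[v]rVpolyK v0 linear0.
have : U (act (phi P) (rVpoly v) e0) by rewrite act_phi_rVpoly.
elim: n (rVpoly v) => // n IH R UR R_neq0 R_le R_lt.
have [S [T [PE T_lt]]] := skew_divp (sigma K) P R_neq0.
have [T0 | T_neq0] := eqVneq T 0; last first.
  apply: (IH T) => //; last exact: leq_trans T_lt _.
    have -> : T = (P : {poly K}) - skew_mul (sigma K) S R.
      by rewrite {1}PE addrC addKr.
    rewrite actBl act_phi_annihilator // (act_skew_mul D Z) sub0r -scaleN1r.
    by apply: UZ; apply: Uact.
  by rewrite ltnW // (leq_trans T_lt).
rewrite T0 addr0 in PE.
have S_neq0 : S != 0.
  apply: contraTneq P_monic => S0; rewrite PE S0.
  rewrite -[0 : {poly K}]/(0%:P) skew_mulCl scale0r monicE lead_coef0.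
  by rewrite eq_sym oner_eq0.
have R_gt0 : (0 < size R)%N by rewrite size_poly_gt0.
(* S cannot be a unit because deg R < d, so R is a nonzero constant and e_0 lies in U. *)
case: (P_irr S R PE) => /skew_unit_size.
  move=> S1; move: R_le; rewrite PE size_skew_mul // S1 add1n /= => R_le.
  by move: (leq_ltn_trans R_le (ltnSn _)); rewrite prednK // ltnn.
move=> /eqP/size_poly1P[c c_neq0 RE].
have -> : e0 = c^-1 *: act (phi P) R e0.
  by rewrite RE actC scalerA mulVf ?scale1r.
exact: UZ.
Qed.

Lemma irreducible_Psi P : (P : {poly K}) \is monic -> irreducible P ->
  irreducible_poly (Psi P).
Proof.
move=> P_monic P_irr; have phiS := phi_simple P_monic P_irr.
have [_ P_nunit _] := P_irr.
have d_gt0 : (0 < (size P).-1)%N.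
  rewrite lt0n; apply/eqP => d0; apply: P_nunit; apply/skew_unit_size.
  by rewrite size_monic_skew // d0.
pose f := iter (\dim {:K}) (phi P).
have fD : {morph f : u v / u + v} by apply: phi_iterD.
have fZ c v : f (c *: v) = c *: f v by apply: phi_iterZ.
pose e0 : 'rV[K]_(size P).-1 := poly_rV 1.
have e0_neq0 : e0 != 0.
  apply/eqP => /rowP/(_ (Ordinal d_gt0)); rewrite !mxE coef1 => /eqP.
  by rewrite oner_eq0.
(* The coefficients of A are fixed by sigma, so the kernel of A(f) is phi-stable and, being nonzero,
   is everything. *)
have ker_size (A : {poly F}) v : A != 0 -> v != 0 ->
    act f (map_poly (in_alg K) A) v = 0 -> ((size P).-1 < size A)%N.
  move=> A_neq0 v_neq0 Av; rewrite -(size_map_poly (in_alg K)).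
  set A' := map_poly _ A in Av *.
  have A's : map_poly (sigma K) A' = A'.
    apply/polyP => i; rewrite !coef_map /= sigmaE -[in RHS](expf_card A`_i).
    exact/esym/(rmorphXn (in_alg K)).
  apply: (simple_semilin_size_ext (@phiD _ _ P) (@phiZ _ _ P) phiS d_gt0) => //.
    by rewrite map_poly_eq0.
  apply: (phiS (fun u => act f A' u = 0)) v_neq0 Av.
  - by move=> u u' Au Au'; rewrite (actDr fD) Au Au' addr0.
  - by move=> c u Au; rewrite (actZr fD fZ) Au scaler0.
  - move=> u Au; rewrite -A's.
    rewrite -[phi P u]/(iter 1 (phi P) u).
    rewrite -(iter_semilin_act_iter (@phiD _ _ P) (@phiZ _ _ P) _ 1) Au.
    exact: (semilin0 (@phiZ _ _ P)).
split; first by rewrite size_Psi ltnS.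
move=> A A_size /dvdpP[B PsiE].
have Psi_neq0 : Psi P != 0 by rewrite -size_poly_gt0 size_Psi.
have [B_neq0 A_neq0] : B != 0 /\ A != 0.
  by apply/andP; rewrite -negb_or -mulf_eq0 -PsiE.
have BA e : act f (map_poly (in_alg K) B) (act f (map_poly (in_alg K) A) e) = 0.
  by rewrite -(actM fD fZ) -rmorphM -PsiE /= map_Psi act_PsiK.
have szBA : (size B + size A)%N = (size P).-1.+2.
  have := size_mul B_neq0 A_neq0; rewrite -PsiE size_Psi => ->.
  by rewrite prednK // addn_gt0 size_poly_gt0 B_neq0.
(* As deg A + deg B = d, a factor with nonzero kernel has full degree and the other is constant. *)
have [Ae0 | Ae0] := eqVneq (act f (map_poly (in_alg K) A) e0) 0.
  have A_gt := ker_size A e0 A_neq0 e0_neq0 Ae0.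
  rewrite -dvdp_size_eqp ?size_Psi; last by rewrite PsiE dvdp_mull.
  rewrite eqn_leq A_gt andbT -(leq_add2l 1) [(1 + _.+1)%N]add1n -szBA.
  by rewrite leq_add2r size_poly_gt0.
have B_gt := ker_size B _ B_neq0 Ae0 (BA e0).
case/negP: A_size; rewrite eqn_leq size_poly_gt0 A_neq0 andbT.
by rewrite -(leq_add2l (size P).-1.+1) addn1 -szBA leq_add2r.
Qed.

Lemma irreducible_of_Psi P : (P : {poly K}) \is monic ->
  irreducible_poly (Psi P) -> irreducible P.
Proof.
move=> P_monic [Psi_gt1 Psi_irr]; have d_gt0 : (0 < (size P).-1)%N.
  by rewrite -ltnS -size_Psi.
have szP := size_monic_skew P_monic.
have P_neq0 : (P : {poly K}) != 0 by rewrite monic_neq0.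
split=> [/eqP | /skew_unit_size P1 | S R PE].
- by apply/negP.
- by rewrite P1 in d_gt0.
have P_skew : (P : {poly K}) = skew_mul (sigma K) S R by [].
have S_neq0 : (S : {poly K}) != 0.
  apply: contraNneq P_neq0 => S0; rewrite P_skew S0.
  by rewrite -[0 : {poly K}]/(0%:P) skew_mulCl scale0r.
have R_neq0 : (R : {poly K}) != 0.
  apply: contraNneq P_neq0 => R0; rewrite P_skew R0; apply/eqP.
  exact: (mulr0 (S : skewpoly (sigma K))).
have szSR : (size S + size R)%N = (size P).+1.
  by rewrite P_skew size_skew_mul // prednK // addn_gt0 size_poly_gt0 S_neq0.
have [S1 | S_neq1] := eqVneq (size S) 1%N; first by left; apply/skew_unit_size.
have [R1 | R_neq1] := eqVneq (size R) 1%N; first by right; apply/skew_unit_size.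
have S_gt1 : (1 < size S)%N by rewrite ltn_neqAle eq_sym S_neq1 size_poly_gt0.
have R_gt1 : (1 < size R)%N by rewrite ltn_neqAle eq_sym R_neq1 size_poly_gt0.
have D := @phiD _ _ P; have Z := @phiZ _ _ P.
pose f := iter (\dim {:K}) (phi P).
have fD : {morph f : u v / u + v} by apply: phi_iterD.
have fZ c v : f (c *: v) = c *: f v by apply: phi_iterZ.
pose e0 : 'rV[K]_(size P).-1 := poly_rV 1.
pose w := act (phi P) R e0.
have R_le : (size R <= (size P).-1)%N.
  by rewrite -(leq_add2l 2) [(2 + (_).-1)%N]add2n -szP -szSR leq_add2r.
have w_neq0 : w != 0.
  rewrite /w act_phi_poly_rV //; apply: contraNneq R_neq0 => w0.
  by rewrite -(poly_rV_K R_le) w0 linear0.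
pose S' : skewpoly (sigma K) := (lead_coef S)^-1 *: (S : {poly K}).
have S'_monic : (S' : {poly K}) \is monic.
  by rewrite monicE lead_coefZ mulVf // lead_coef_eq0.
have szS' : size S' = size S by rewrite size_scale // invr_eq0 lead_coef_eq0.
have S'w : act (phi P) S' w = 0.
  by rewrite actZl -(act_skew_mul D Z) -P_skew act_phi_annihilator // scaler0.
(* The annihilator is computed in D_S', where Psi(S')(X^r) kills the generator; the resulting
   factorisation is then applied to w in D_P. *)
have PsiS'w : act f (PsiK S') w = 0.
  have [T TE] : exists T, PsiK S' \Po 'X^(\dim {:K}) = skew_mul (sigma K) T S'.
    by apply: skew_annihilator => //; rewrite -act_iter act_PsiK.
  by rewrite act_iter TE (act_skew_mul D Z) S'w (act0r Z).
have : coprimep (Psi P) (Psi S').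
  rewrite irreducible_poly_coprime //; apply/negP => /dvdp_leq.
  rewrite -size_poly_gt0 !size_Psi szS' => /(_ isT); rewrite ltnS.
  rewrite leqNgt => /negP; apply.
  rewrite -ltnS -szP prednK ?size_poly_gt0 // -ltnS -szSR.
  by rewrite -[(size S).+1]addn1 ltn_add2l.
case/Bezout_eq1_coprimepP => -[a b] /= /(congr1 (map_poly (in_alg K))).
rewrite rmorphD !rmorphM /= !map_Psi rmorph1 => ab1; case/eqP: w_neq0.
rewrite -[w]scale1r -(actC f) polyC1 -ab1 actDl !(actM fD fZ).
by rewrite act_PsiK PsiS'w !(actr0 fD fZ) addr0.
Qed.

End Irreducibility.

Theorem corollary2p4p7 (p a r : nat) (p_prime : prime p) (a_gt0 : (0 < a)%N)
    (r_gt0 : (0 < r)%N) (F : finFieldType) (cardF : #|F| = (p ^ a)%N)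
    (K : fieldExtType F) (dimK : \dim {:K} = r)
    (P : skewpoly (sigma K)) (P_monic : (P : {poly K}) \is monic) :
  irreducible P <-> irreducible_poly (Psi P).
Proof.
by split; [apply: irreducible_Psi | apply: irreducible_of_Psi].
Qed.
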